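(* Let $G$ be a finite connected cubic graph. Then the following are equivalent: (i) $\mathrm{Fl}\,G$ is distributive; (ii) $\mathrm{Fl}\,G$ is modular; (iii) $\mathrm{Fl}\,G$ is semimodular; (iv) $\mathrm{Fl}\,G$ is geometric; (v) $G\cong K_4$ or $G\cong K_{3,3}$.
   Context: Graphs are finite, undirected, without loops or multiple edges; cubic means every vertex has degree 3. $\mathrm{St}(v)$ is the set of neighbours of $v$, $\mathrm{St}(W)=\bigcap_{w\in W}\mathrm{St}(w)$ with $\mathrm{St}(\emptyset)=V$, and $\mathrm{Fl}\,G=\{\mathrm{St}(W)\mid W\subseteq V\}$ ordered by inclusion; it is a lattice with meet $\cap$ and join of $X,Y$ the smallest flat containing $X\cup Y$. A lattice is distributive if $p\wedge(q\vee r)=(p\wedge q)\vee(p\wedge r)$ for all $p,q,r$. It is modular if it has no sublattice consisting of five distinct elements $a,b,c,d,e$ with $e<c<b<a$, $e<d<a$, $b\vee d=c\vee d=a$, $b\wedge d=c\wedge d=e$; it is semimodular if it has no such sublattice in which $d$ covers $e$. An atom is an element covering the minimum; a lattice is geometric if it is semimodular and every element is a join of atoms (the minimum being the empty join). *)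

(* Defs.v *)
From HB Require Import structures.
From mathcomp Require Import all_boot all_order.

Set Implicit Arguments.
Unset Strict Implicit.
Unset Printing Implicit Defensive.

Import Order.TTheory.
Local Open Scope order_scope.

Section LatticeNotions.
Variables (disp : Order.disp_t).

Definition distributive_lattice (L : latticeType disp) : Prop :=
  forall p q r : L, p `&` (q `|` r) = (p `&` q) `|` (p `&` r).

Definition sublattice (L : latticeType disp) (S : {pred L}) : Prop :=
  {in S &, forall x y, x `&` y \in S /\ x `|` y \in S}.

Definition pentagon (L : latticeType disp) (a b c d e : L) : Prop :=
  [/\ uniq [:: a; b; c; d; e] /\ sublattice (mem [:: a; b; c; d; e]),
      [/\ e < c, c < b & b < a],
      e < d < a,
      b `|` d = a /\ c `|` d = a &
      b `&` d = e /\ c `&` d = e].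

Definition modular_lattice (L : latticeType disp) : Prop :=
  forall a b c d e : L, ~ pentagon a b c d e.

Definition covers (L : porderType disp) (y x : L) : Prop :=
  x < y /\ forall z : L, ~~ (x < z < y).

(* The covering relation [covers d e] is that of the whole lattice L; inside
   the pentagon itself d always covers e. *)
Definition semimodular_lattice (L : latticeType disp) : Prop :=
  forall a b c d e : L, ~ (pentagon a b c d e /\ covers d e).

Definition atom (L : bPOrderType disp) (x : L) : Prop := covers x \bot.

Definition geometric_lattice (L : finTBLatticeType disp) : Prop :=
  semimodular_lattice L /\
  forall x : L, exists2 A : {set L},
    {in A, forall a, atom a} & x = \join_(a in A) a.

End LatticeNotions.

Record sgraph := SGraph {
  vertex :> finType;
  adj : rel vertex;
  adj_sym : symmetric adj;
  adj_irr : irreflexive adj }.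

Definition connected (G : sgraph) : Prop :=
  (0 < #|G|)%N /\ forall x y : G, connect (@adj G) x y.

Definition isomorphic (G H : sgraph) : Prop :=
  exists2 f : G -> H, bijective f & forall x y, adj (f x) (f y) = adj x y.

Section Complete.
Variable n : nat.

Definition complete_adj (x y : 'I_n) : bool := x != y.

Fact complete_sym : symmetric complete_adj.
Proof. by move=> x y; rewrite /complete_adj eq_sym. Qed.

Fact complete_irr : irreflexive complete_adj.
Proof. by move=> x; rewrite /complete_adj eqxx. Qed.

Definition complete_graph : sgraph := SGraph complete_sym complete_irr.
End Complete.

Section CompleteBipartite.
Variables m n : nat.

Definition bipartite_adj (x y : 'I_m + 'I_n) : bool :=
  match x, y with
  | inl _, inr _ | inr _, inl _ => true
  | _, _ => false
  end.

Fact bipartite_sym : symmetric bipartite_adj.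
Proof. by case=> ? []. Qed.

Fact bipartite_irr : irreflexive bipartite_adj.
Proof. by case. Qed.

Definition complete_bipartite_graph : sgraph :=
  SGraph bipartite_sym bipartite_irr.
End CompleteBipartite.

Section Flats.
Variable G : sgraph.
Implicit Types (v : G) (W X Y : {set G}).

Definition star v : {set G} := [set w | adj v w].

(* The empty intersection is [set: G]. *)
Definition starW W : {set G} := \bigcap_(w in W) star w.

Definition flats : {set {set G}} := [set starW W | W : {set G}].

Record flat := Flat { flat_set :> {set G}; flatP : flat_set \in flats }.

HB.instance Definition _ := [isSub for flat_set].
HB.instance Definition _ := [Finite of flat by <:].

Lemma starW_flat W : starW W \in flats.
Proof. exact: imset_f. Qed.

Lemma flatI X Y : X \in flats -> Y \in flats -> X :&: Y \in flats.
Proof.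
move=> /imsetP[A _ ->] /imsetP[B _ ->].
suff -> : starW A :&: starW B = starW (A :|: B) by exact: starW_flat.
by rewrite /starW bigcap_setU.
Qed.

Lemma flatT : [set: G] \in flats.
Proof.
suff <- : starW set0 = [set: G] by exact: starW_flat.
by rewrite /starW big_set0.
Qed.

Lemma flat0 : set0 \in flats.
Proof.
suff <- : starW [set: G] = set0 by exact: starW_flat.
apply/setP=> x; rewrite inE; apply/negP=> /bigcapP/(_ x (in_setT x)).
by rewrite inE adj_irr.
Qed.

(* The smallest flat containing X. *)
Definition flat_closure X : {set G} :=
  \bigcap_(Z in flats | X \subset Z) Z.

Lemma flat_closureP X : flat_closure X \in flats.
Proof.
rewrite /flat_closure; elim/big_ind: _ => [|Y Z|Y /andP[]//].
  exact: flatT.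
exact: flatI.
Qed.

Definition flat_le (X Y : flat) : bool := (X : {set G}) \subset Y.
Definition flat_meet (X Y : flat) : flat := Flat (flatI (flatP X) (flatP Y)).
Definition flat_join (X Y : flat) : flat := Flat (flat_closureP (X :|: Y)).

Fact flat_le_refl : reflexive flat_le.
Proof. by move=> X; apply: subxx. Qed.

Fact flat_le_anti : antisymmetric flat_le.
Proof. by move=> X Y XY; apply/val_inj/eqP; rewrite eqEsubset. Qed.

Fact flat_le_trans : transitive flat_le.
Proof. by move=> Y X Z; apply: subset_trans. Qed.

Fact flat_disp : Order.disp_t. Proof. exact. Qed.

HB.instance Definition _ := Order.Le_isPOrder.Build flat_disp flat
  flat_le_refl flat_le_anti flat_le_trans.

Fact flat_lexI (X Y Z : flat) :
  (X <= flat_meet Y Z) = (X <= Y) && (X <= Z).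
Proof. exact: subsetI. Qed.

Fact flat_leUx (X Y Z : flat) :
  (flat_join X Y <= Z) = (X <= Z) && (Y <= Z).
Proof.
rewrite -[RHS]subUset; apply/idP/idP => [|XYZ].
  by apply: subset_trans; apply/bigcapsP => ? /andP[].
by apply: (bigcap_inf (val Z)); rewrite (flatP Z).
Qed.

Fact flat_le0x (X : flat) : Flat flat0 <= X.
Proof. exact: sub0set. Qed.

Fact flat_lex1 (X : flat) : X <= Flat flatT.
Proof. exact: subsetT. Qed.

HB.instance Definition _ :=
  Order.POrder_isMeetSemilattice.Build flat_disp flat flat_lexI.
HB.instance Definition _ :=
  Order.POrder_isJoinSemilattice.Build flat_disp flat flat_leUx.
HB.instance Definition _ :=
  Order.hasBottom.Build flat_disp flat flat_le0x.
HB.instance Definition _ :=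
  Order.hasTop.Build flat_disp flat flat_lex1.

Definition flat_lattice : finTBLatticeType flat_disp := flat.

Definition cubic : Prop := forall v, #|star v| = 3.

End Flats.

(* Main.v *)
(**
Write St for the order-reversing involution X |-> starW X on flats.  In a cubic
graph St(St w) is the class of vertices with the same star as w; these classes
are the atoms, and every flat is a union of them, so Fl G is always atomistic.

Suppose Fl G is semimodular and star v, star w are disjoint.  A flat X strictly
between set0 and star v gives the pentagon
set0 < St(St v) < St X < V with side element the atom St(St w), so star v is an
atom of Fl G.  If moreover v and w are adjacent, then every star meeting star v
or star w equals it, and G is K33.  If no edge vw has disjoint stars, every edge
lies in a triangle, which in a connected cubic graph forces K4.
Conversely, K4 and K33 are complete multipartite, and the flats of such a graph
are the unions of its parts.
*)
Require Import Defs.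
From mathcomp Require Import all_boot all_order.

Set Implicit Arguments.
Unset Strict Implicit.
Unset Printing Implicit Defensive.

Import Order.TTheory.
Local Open Scope order_scope.

(** * Pentagon sublattices and the general lattice implications *)

Section Pentagons.
Variables (disp : Order.disp_t) (L : latticeType disp).

(** The other two pentagon equations follow by monotonicity from [c < b]. If [d] were [b] or [c],
    its meet with [d] would be [d] itself, forcing [d = e]. *)
Lemma pentagonI (a b c d e : L) :
  e < c -> c < b -> b < a -> e < d -> d < a ->
  c `|` d = a -> b `&` d = e -> pentagon a b c d e.
Proof.
move=> ec cb ba ed da cd_a bd_e.
have bd_a : b `|` d = a.
  apply/le_anti; rewrite leUx (ltW ba) (ltW da) /= -cd_a.
  by rewrite leUx leUr (le_trans (ltW cb) (leUl _ _)).
have cd_e : c `&` d = e.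
  apply/le_anti; rewrite lexI (ltW ec) (ltW ed) -bd_e.
  by rewrite lexI leIr (le_trans (leIl _ _) (ltW cb)).
have [eb ca] := (lt_trans ec cb, lt_trans cb ba).
have ea := lt_trans ed da.
have nbd : b != d by apply: contraTneq ed => bd; rewrite -bd_e -bd meetxx bd ltxx.
have ncd : c != d by apply: contraTneq ed => cd; rewrite -cd_e -cd meetxx cd ltxx.
have ch (x y : L) : x < y ->
    [/\ x `&` y = x, y `&` x = x, x `|` y = y & y `|` x = y].
  by move=> /ltW xy; rewrite [y `&` x]meetC [y `|` x]joinC meet_l // join_r.
have [db_e db_a] : d `&` b = e /\ d `|` b = a by rewrite meetC joinC.
have [dc_e dc_a] : d `&` c = e /\ d `|` c = a by rewrite meetC joinC.
split=> //; last by rewrite ed.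
split.
  rewrite /= !inE !negb_or (gt_eqF ba) (gt_eqF ca) (gt_eqF da) (gt_eqF ea).
  by rewrite (gt_eqF cb) (gt_eqF eb) (gt_eqF ec) (gt_eqF ed) nbd ncd.
(* The meets and joins of all eight comparable pairs enter the context, so each of the 25 closure
   cases is one rewrite. *)
move: (ch _ _ ec) (ch _ _ cb) (ch _ _ ba) (ch _ _ ed) (ch _ _ da).
move: (ch _ _ eb) (ch _ _ ca) (ch _ _ ea).
do 8![case=> ? ? ? ?].
move=> x y; rewrite !inE => /or4P[|||/orP[]] /eqP-> /or4P[|||/orP[]] /eqP->;
  rewrite ?meetxx ?joinxx; split;
  match goal with H : ?u = _ |- context [?u] => rewrite H | _ => idtac end;
  by rewrite eqxx ?orbT.
Qed.

(** In a pentagon, distributivity would give [b] = b ∧ (c ∨ d) = (b ∧ c) ∨ (b ∧ d) = c ∨ e = [c]. *)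
Lemma distributive_modular : distributive_lattice L -> modular_lattice L.
Proof.
move=> distr a b c d e [_ [ec cb ba] _ [_ cd_a] [bd_e _]].
have := distr b c d; rewrite cd_a bd_e (meet_l (ltW ba)) (meet_r (ltW cb)).
by rewrite (join_l (ltW ec)) => bc; rewrite bc ltxx in cb.
Qed.

Lemma modular_semimodular : modular_lattice L -> semimodular_lattice L.
Proof. by move=> mod a b c d e [/mod]. Qed.

End Pentagons.

(** * Stars and flats *)

Section FlatLattice.
Variable G : sgraph.
Implicit Types (u v w x y : G) (W X Y : {set G}).

Lemma in_star v w : (w \in star v) = adj v w.
Proof. by rewrite inE. Qed.

Lemma starWP W x : reflect {in W, forall w, adj w x} (x \in starW W).
Proof.
apply: (iffP bigcapP) => H w /H; first by rewrite in_star.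
by rewrite in_star.
Qed.

Lemma starW1 v : starW [set v] = star v.
Proof. by rewrite /starW big_set1. Qed.

Lemma star_flat v : star v \in flats G.
Proof. by rewrite -starW1 starW_flat. Qed.

(** By symmetry of [adj], [starW] forms a Galois connection with itself, and flats are its closed
    sets. *)
Lemma starWK X : X \in flats G -> starW (starW X) = X.
Proof.
case/imsetP=> W _ ->; apply/setP=> x; apply/starWP/starWP => H w.
  by move=> wW; apply: H; apply/starWP=> z /starWP/(_ w wW); rewrite adj_sym.
by move=> /starWP Hw; rewrite adj_sym; apply: Hw; apply/starWP.
Qed.


Lemma flat_sub_star X : X \in flats G -> X != setT -> exists z, X \subset star z.
Proof.
case/imsetP=> W _ ->; have [->|[z zW] _] := set_0Vmem W.
  by rewrite /starW big_set0 eqxx.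
by exists z; apply: bigcap_inf.
Qed.

(** Serves to show that an explicit set of vertices exhausts [G], both for K33 and for K4. *)
Lemma connected_closed X x : connected G -> x \in X ->
  {in X, forall y, star y \subset X} -> X = setT.
Proof.
move=> [_ conn] xX clX; apply/setP=> y; rewrite in_setT.
have clo : closed (@adj G) (mem X).
  move=> u v uv; apply/idP/idP => [uX|vX].
    by apply: (subsetP (clX u uX)); rewrite in_star.
  by apply: (subsetP (clX v vX)); rewrite in_star adj_sym.
by rewrite -(closed_connect clo (conn x y)).
Qed.

Definition twins w : flat_lattice G := Flat (starW_flat (star w)).

Lemma twins_refl w : w \in (twins w : {set G}).
Proof. by apply/starWP=> u; rewrite in_star adj_sym. Qed.

Section Cubic.
Hypothesis Gcubic : cubic G.

(** All stars have three elements, so no inclusion between them is proper. *)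
Lemma star_eq v w : star v \subset star w -> star v = star w.
Proof. by move=> vw; apply/eqP; rewrite eqEcard vw !Gcubic. Qed.

Lemma twinsP w x : reflect (star x = star w) (x \in (twins w : {set G})).
Proof.
apply: (iffP (starWP _ _)) => [H|E u].
  apply/esym/star_eq/subsetP=> u /H; by rewrite in_star adj_sym.
by rewrite -E in_star adj_sym.
Qed.

Lemma twins_atom w : atom (twins w).
Proof.
split=> [|Z]; first rewrite lt0x.
  by apply: contraTneq (twins_refl w) => ->; rewrite inE.
apply/negP=> /andP[]; rewrite lt0x => Z0; rewrite lt_neqAle => /andP[/negP + /subsetP Zw].
apply; apply/eqP/val_inj/eqP; rewrite /= eqEsubset.
have [z zZ] : exists z, z \in (Z : {set G}).
  by apply/set0Pn; apply: contraNneq Z0 => Z0; apply/eqP/val_inj.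
apply/andP; split; first exact/subsetP.
(* Membership in [starW (starW Z)] depends only on the star of a vertex, so [Z] contains all twins
   of [z]. *)
rewrite -(starWK (flatP Z)).
apply/subsetP=> x /twinsP xw; apply/starWP=> u /starWP Hu.
have : u \in star z by rewrite in_star; apply: Hu.
by rewrite (twinsP _ _ (Zw _ zZ)) -xw in_star adj_sym.
Qed.

Lemma flat_join_atoms (X : flat_lattice G) :
  exists2 A : {set flat_lattice G},
    {in A, forall a, atom a} & X = \join_(a in A) a.
Proof.
exists [set twins x | x in (X : {set G})].
  by move=> _ /imsetP[x _ ->]; apply: twins_atom.
apply/le_anti/andP; split.
  apply/subsetP=> x xX.
  apply: (subsetP _ _ (twins_refl x)).
  exact: (@joins_sup _ _ _ (twins x) _ id (imset_f _ xX)).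
apply/joinsP=> _ /imsetP[x xX ->]; apply/subsetP=> y /twinsP xy.
rewrite -(starWK (flatP X)); apply/starWP=> u /starWP Hu.
by rewrite adj_sym -in_star xy in_star; apply: Hu.
Qed.

Lemma semimodular_geometric :
  semimodular_lattice (flat_lattice G) -> geometric_lattice (flat_lattice G).
Proof. by split=> //; apply: flat_join_atoms. Qed.

Lemma star_neqT v : star v != setT.
Proof. by apply: contraTneq (in_setT v) => <-; rewrite in_star adj_irr. Qed.

Lemma star_neq0 v : star v != set0.
Proof. by rewrite -card_gt0 Gcubic. Qed.

(** * Semimodularity and disjoint stars *)

Lemma semimodular_disjoint_star v w X :
    semimodular_lattice (flat_lattice G) -> [disjoint star v & star w] ->
    X \in flats G -> X \subset star v -> X != set0 -> X = star v.
Proof.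
move=> semi vw Xfl Xv X0; apply/eqP; apply: contraT => nXv.
case: (semi \top (Flat (starW_flat X)) (twins v) (twins w) \bot).
split; last exact: twins_atom.
have [tv _] := twins_atom v; have [tw _] := twins_atom w.
have [x xX] := set0Pn _ X0.
have StX : starW X \subset star x by exact: bigcap_inf.
apply: pentagonI => //.
- rewrite lt_neqAle; apply/andP; split.
    apply: contraNneq nXv => /(congr1 val) /= E.
    by rewrite -(starWK Xfl) -E (starWK (star_flat v)).
  apply/subsetP=> y /twinsP yv; apply/starWP=> u /(subsetP Xv).
  by rewrite -yv in_star adj_sym.
- rewrite ltx1; apply: contraNneq (star_neqT x) => /(congr1 val) /= E.
  by rewrite eqEsubset subsetT -E.
- rewrite ltx1; apply: contraTneq (in_setT v) => /(congr1 val) /= E.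
  rewrite -E; apply/twinsP=> E'; move: vw; rewrite -E' -setI_eq0 setIid.
  by rewrite (negbTE (star_neq0 v)).
(* A proper flat containing [v] and [w] would lie in some [star z], making [z] a common neighbour of
   [v] and [w]. *)
- apply/val_inj/eqP; apply: contraT => /(flat_sub_star (flatP _)) [z /subsetP Hz].
  have zv : z \in star v.
    rewrite in_star adj_sym -in_star; apply: Hz.
    exact: (subsetP (leUl (twins v) (twins w)) _ (twins_refl v)).
  have zw : z \in star w.
    rewrite in_star adj_sym -in_star; apply: Hz.
    exact: (subsetP (leUr (twins w) (twins v)) _ (twins_refl w)).
  by rewrite (disjointFr vw zv) in zw.
(* A twin [y] of [w] in [starW X] is adjacent to [x], so [x] would lie in both [star w] and
   [star v]. *)
- apply/val_inj/eqP => /=; apply: contraT => /set0Pn[y].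
  rewrite inE => /andP[/(subsetP StX) xy /twinsP yw].
  have : x \in star w by rewrite -yw in_star adj_sym -in_star.
  by rewrite (disjointFr vw (subsetP Xv _ xX)).
Qed.

(** The intersection of [star v] and [star u] is a nonempty flat below [star v], hence all of
    [star v]. *)
Lemma semimodular_star_meet v w u :
    semimodular_lattice (flat_lattice G) -> [disjoint star v & star w] ->
    star v :&: star u != set0 -> star u = star v.
Proof.
move=> semi vw vu; apply/esym/star_eq/setIidPl.
apply: (semimodular_disjoint_star semi vw _ _ vu); last exact: subsetIl.
exact: flatI (star_flat v) (star_flat u).
Qed.

Lemma disjoint_edge_K33 v w : connected G ->
    semimodular_lattice (flat_lattice G) -> adj v w ->
    [disjoint star v & star w] -> isomorphic G (complete_bipartite_graph 3 3).
Proof.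
move=> conn semi vw dvw.
(* Here [star x] meets [star w] in [v]; symmetrically, [starw] uses the common vertex [w]. *)
have starv x : x \in star v -> star x = star w.
  move=> xv; apply: (semimodular_star_meet semi (v := w) (w := v)).
    by rewrite disjoint_sym.
  by apply/set0Pn; exists v; rewrite !inE adj_sym vw adj_sym -in_star.
have starw x : x \in star w -> star x = star v.
  move=> xw; apply: (semimodular_star_meet semi dvw).
  by apply/set0Pn; exists w; rewrite !inE vw adj_sym -in_star.
have VT : star v :|: star w = setT.
  apply: (@connected_closed _ w) => //; first by rewrite !inE vw.
  by move=> x /setUP[/starv|/starw] ->; [apply: subsetUr|apply: subsetUl].
have inW x : (x \in star w) = (x \notin star v).
  have := in_setT x; rewrite -VT inE.
  case: (boolP (x \in star v)) => [xv|] //= _; exact: disjointFr dvw xv.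
have adjE x y : adj x y = (x \in star v) (+) (y \in star v).
  rewrite -[LHS]in_star; case: (boolP (x \in star v)) => xv.
    by rewrite starv ?inW.
  by rewrite starw ?inW.
(* These two memberships supply the default elements that [enum_rank_in] needs to number each
   side. *)
have wv : w \in star v by rewrite in_star.
have vw' : v \in star w by rewrite in_star adj_sym.
pose f x : 'I_3 + 'I_3 :=
  if x \in star v then inl (cast_ord (Gcubic v) (enum_rank_in wv x))
  else inr (cast_ord (Gcubic w) (enum_rank_in vw' x)).
have f_inj : injective f.
  rewrite /f => x y; case: ifPn => xv; case: ifPn => yv // [].
    by move=> /ord_inj /enum_rank_in_inj; apply.
  by move=> /ord_inj /enum_rank_in_inj; apply; rewrite inW.
exists f.
  apply: inj_card_bij => //.
  rewrite card_sum !card_ord -cardsT -VT cardsU disjoint_setI0 //.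
  by rewrite !Gcubic cards0.
by move=> x y; rewrite adjE /f; case: ifPn => xv; case: ifPn => yv.
Qed.

Lemma star_set3 x p q r : uniq [:: p; q; r] ->
  adj x p -> adj x q -> adj x r -> star x = [set p; q; r].
Proof.
move=> Upqr xp xq xr; apply/esym/eqP; rewrite eqEcard Gcubic; apply/andP; split.
  by apply/subsetP=> y /[!inE] /orP[/orP[]|] /eqP->.
have -> : [set p; q; r] = [set:: [:: p; q; r]].
  by apply/setP=> y; rewrite !inE orbA.
by rewrite cardsE (card_uniqP Upqr).
Qed.

(** Each star omits its own vertex and has three of the four vertices, so it omits nothing else. *)
Lemma complete4_iso : #|G| = 4 -> isomorphic G (complete_graph 4).
Proof.
move=> G4; exists (fun x => cast_ord G4 (enum_rank x)).
  apply: inj_card_bij; last by rewrite card_ord G4.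
  by move=> x y /cast_ord_inj /enum_rank_inj.
have starE x : star x = ~: [set x].
  apply/eqP; rewrite eqEcard Gcubic cardsC1 G4 leqnn andbT.
  by apply/subsetP=> y; rewrite !inE; apply: contraTneq => ->; rewrite adj_irr.
move=> x y; rewrite -[RHS]in_star starE !inE /= /complete_adj.
by rewrite (inj_eq (@cast_ord_inj _ _ _)) (inj_eq enum_rank_inj) eq_sym.
Qed.

(** * Graphs in which every edge lies in a triangle *)

Section Triangles.
Hypothesis conn : connected G.
Hypothesis triangle : forall v w, adj v w -> ~~ [disjoint star v & star w].

(** The neighbourhood of [v] contains the path [a], [b], [c]. Once [a] and [c] are shown adjacent,
    these four vertices are closed under taking neighbours. *)
Lemma triangle_K4 v a b c : uniq [:: a; b; c] -> star v = [set a; b; c] ->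
  adj b a -> adj b c -> isomorphic G (complete_graph 4).
Proof.
move=> Uabc sv ba bc.
have [va vb vc] : [/\ adj v a, adj v b & adj v c].
  by rewrite -!in_star sv !inE !eqxx !orbT.
have neq x y : adj x y -> (x == y) = false.
  by move=> xy; apply: contraTF xy => /eqP->; rewrite adj_irr.
move: (Uabc); rewrite /= !inE negb_or !andbT => /andP[/andP[ab ac] nbc].
have sb : star b = [set v; a; c].
  apply: star_set3 => //; last by rewrite adj_sym.
  by rewrite /= !inE !negb_or (neq _ _ va) (neq _ _ vc) ac.
have adjac : adj a c.
  apply: contraT => nac.
  have : ~~ (star a \subset [set v; b]).
    apply/negP=> /subset_leq_card; rewrite Gcubic cards2.
    by case: (v != b).
  case/subsetPn=> x; rewrite !inE negb_or => ax /andP[xv xb].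
  have xc : x != c by apply: contraNneq nac => <-.
  have sa : star a = [set v; b; x].
    apply: star_set3 => //; try by rewrite adj_sym.
    by rewrite /= !inE !negb_or (neq _ _ vb) ![_ == x]eq_sym xv xb.
  have xa : (x == a) = false by rewrite eq_sym neq.
  (* The third vertex of a triangle on the edge from [a] to [x] must be [v] or [b], but their stars
     are already full without [x]. *)
  have /pred0Pn[y /andP[]] := triangle ax; rewrite sa !inE.
  move=> /orP[/orP[]|] /eqP-> /=; last by rewrite adj_irr.
    by rewrite adj_sym -in_star sv !inE xa (negbTE xb) (negbTE xc).
  by rewrite adj_sym -in_star sb !inE xa (negbTE xv) (negbTE xc).
apply: complete4_iso; rewrite -cardsT.
have U : uniq [:: v; a; b; c].
  by rewrite cons_uniq Uabc !inE !negb_or (neq _ _ va) (neq _ _ vb) (neq _ _ vc).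
have <- : [set:: [:: v; a; b; c]] = [set: G].
  apply: (@connected_closed _ v) => //; first by rewrite !inE eqxx.
  have sa : star a = [set v; b; c].
    apply: star_set3 => //; try by rewrite adj_sym.
    by rewrite /= !inE !negb_or (neq _ _ vb) (neq _ _ vc) (neq _ _ bc).
  have sc : star c = [set v; a; b].
    apply: star_set3 => //; try by rewrite adj_sym.
    by rewrite /= !inE !negb_or (neq _ _ va) (neq _ _ vb) eq_sym (neq _ _ ba).
  move=> y; rewrite !inE => /or4P[] /eqP->; rewrite ?sv ?sa ?sb ?sc;
  by apply/subsetP=> z; rewrite !inE => /orP[/orP[]|] ->; rewrite ?orbT.
by rewrite cardsE (card_uniqP U).
Qed.


(** The triangle on each edge at [v] gives every neighbour of [v] a partner among the other two.
    Three vertices with no isolated one contain a path, and [triangle_K4] applies to its middle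
    vertex. *)
Lemma triangles_K4 : isomorphic G (complete_graph 4).
Proof.
have /card_gt0P[v _] := conn.1.
case E: (enum (star v)) (cardE (star v)) => [|a [|b [|c []]]]; rewrite Gcubic // => _.
have sv : star v = [set a; b; c].
  by apply/setP=> x; rewrite -mem_enum E !inE orbA.
have U : uniq [:: a; b; c] by rewrite -E enum_uniq.
have partner x : x \in star v -> exists2 y, y \in [set a; b; c] & adj x y.
  rewrite in_star => /triangle/pred0Pn[y /andP[/= yv xy]].
  by exists y; [rewrite -sv|rewrite -in_star].
(* Any of the three neighbours may be the middle vertex [q]. *)
have center p q r : perm_eq [:: a; b; c] [:: p; q; r] ->
    adj q p -> adj q r -> isomorphic G (complete_graph 4).
  move=> perm; apply: (@triangle_K4 v); first by rewrite -(perm_uniq perm).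
  rewrite sv; apply/setP=> x; move: (perm_mem perm x).
  by rewrite !inE !orbA.
have perm132 x y z : perm_eq [:: x; y; z] [:: x; z; y].
  by rewrite perm_cons (perm_catC [:: y] [:: z]).
have perm213 x y z : perm_eq [:: x; y; z] [:: y; x; z].
  by rewrite (perm_cat2r [:: z] [:: x; y] [:: y; x]) (perm_catC [:: x] [:: y]).
have K4_bac : adj a b -> adj a c -> isomorphic G (complete_graph 4).
  exact: center (perm213 a b c).
have [y] := partner a ltac:(by rewrite sv !inE eqxx).
(* If [a] is joined to [b], the partner of [c] is the middle vertex; if [a] is joined to [c], the
   partner of [b] is. *)
rewrite !inE => /orP[/orP[]|] /eqP-> aab; first by rewrite adj_irr in aab.
  have [z] := partner c ltac:(by rewrite sv !inE eqxx orbT).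
  rewrite !inE => /orP[/orP[]|] /eqP-> ccz; last by rewrite adj_irr in ccz.
    by apply: K4_bac; rewrite // adj_sym.
  by apply: (center a b c) => //; rewrite adj_sym.
have [z] := partner b ltac:(by rewrite sv !inE eqxx orbT).
rewrite !inE => /orP[/orP[]|] /eqP-> bbz.
- by apply: K4_bac; rewrite // adj_sym.
- by rewrite adj_irr in bbz.
by apply: (center a c b) => //; rewrite adj_sym.
Qed.

End Triangles.

Lemma semimodular_K4_K33 : connected G ->
  semimodular_lattice (flat_lattice G) ->
  isomorphic G (complete_graph 4) \/ isomorphic G (complete_bipartite_graph 3 3).
Proof.
move=> conn semi.
pose disjoint_edge (e : G * G) := adj e.1 e.2 && [disjoint star e.1 & star e.2].
case: (pickP disjoint_edge) => [[v w] /andP[/= vw dvw]|no_edge].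
  by right; apply: (disjoint_edge_K33 conn semi vw dvw).
left; apply: (triangles_K4 conn) => v w vw.
by have := no_edge (v, w); rewrite /disjoint_edge /= vw /= => ->.
Qed.

End Cubic.

(** * Distributivity for complete multipartite graphs *)

(** Joins become unions, so distributivity is inherited from sets. *)
Lemma flat_setU_distributive :
  {in flats G &, forall X Y, X :|: Y \in flats G} ->
  distributive_lattice (flat_lattice G).
Proof.
move=> flU.
have joinE (X Y : flat_lattice G) :
    X `|` Y = Flat (flU _ _ (flatP X) (flatP Y)) :> flat_lattice G.
  apply/le_anti; rewrite leUx -andbA; apply/and3P.
  split; [exact: subsetUl|exact: subsetUr|].
  by rewrite /Order.le /= /flat_le /= subUset; apply/andP; split;
    [apply: (leUl X Y)|apply: (leUr Y X)].
by move=> p q r; rewrite !joinE; apply/val_inj/setIUr.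
Qed.

(* Transitivity of non-adjacency says that G is complete multipartite. *)
Lemma multipartite_distributive :
  (forall x y z : G, ~~ adj x y -> ~~ adj y z -> ~~ adj x z) ->
  distributive_lattice (flat_lattice G).
Proof.
move=> nadj_trans; apply: flat_setU_distributive => X Y Xfl Yfl.
have flat_saturated (Z : {set G}) x y :
    Z \in flats G -> x \in Z -> ~~ adj x y -> y \in Z.
  case/imsetP=> W _ -> /starWP Hx xy; apply/starWP=> u uW.
  apply: contraT => uy; have := nadj_trans u y x uy.
  by rewrite adj_sym xy Hx // => /(_ isT).
have XYs x y : x \in X :|: Y -> ~~ adj x y -> y \in X :|: Y.
  by rewrite !inE => /orP[] xZ xy; rewrite (flat_saturated _ _ _ _ xZ xy) ?orbT.
(* A union of parts is adjacent to every vertex outside it, while an outside vertex is not adjacent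
   to itself. *)
suff -> : X :|: Y = starW (~: (X :|: Y)) by exact: starW_flat.
apply/setP=> x; apply/idP/starWP => [xXY u|H].
  by rewrite in_setC; apply: contraR; rewrite adj_sym; apply: XYs.
by apply: contraT; rewrite -in_setC => /H; rewrite adj_irr.
Qed.

(** Non-adjacency is equality in K4 and lying on the same side in K33; both are transitive. *)
Lemma K4_K33_distributive :
  isomorphic G (complete_graph 4) \/ isomorphic G (complete_bipartite_graph 3 3) ->
  distributive_lattice (flat_lattice G).
Proof.
case=> -[f _ fadj]; apply: multipartite_distributive => x y z; rewrite -!fadj /=.
  by rewrite /complete_adj !negbK => /eqP->.
by case: (f x) (f y) (f z) => ? [] ? [].
Qed.

End FlatLattice.

Theorem theorem7p4 (G : sgraph) (Gconn : connected G) (Gcubic : cubic G) :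
  [<-> distributive_lattice (flat_lattice G);
       modular_lattice (flat_lattice G);
       semimodular_lattice (flat_lattice G);
       geometric_lattice (flat_lattice G);
       isomorphic G (complete_graph 4) \/
       isomorphic G (complete_bipartite_graph 3 3)].
Proof.
tfae.
- exact: distributive_modular.
- exact: modular_semimodular.
- exact: semimodular_geometric.
- by case=> semi _; apply: semimodular_K4_K33.
- exact: K4_K33_distributive.
Qed.
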